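(* Assume that the piecewise affine system $P=(X^0,\mathcal{X},\mathcal{A})$ admits a piecewise quadratic Lyapunov (PQL) function $L$ characterized by a family $\{(P^i,q^i) : P^i\in\mathbb{S}_d,\ q^i\in\mathbb{R}^d,\ i\in\mathcal{I}\}$ and reals $\alpha$ and $\beta$. For $i\in\mathcal{I}$ let $S_\alpha^i=\{x\in X^i\mid L^i(x)\le\alpha\}=\{x\in X^i\mid x^\intercal P^i x+2x^\intercal q^i\le\alpha\}$ and let $S=\bigcup_{i\in\mathcal{I}}S_\alpha^i$. Then $\mathcal{R}\subseteq S\subseteq\{x\in\mathbb{R}^d\mid \|x\|_2^2\le\beta\}$.
   Context: Vector inequalities are coordinatewise. $\mathbb{S}_n$ is the set of real symmetric $n\times n$ matrices; $\mathbb{M}_{n\times m}$ is the set of real $n\times m$ matrices. **Piecewise affine system.** $P=(X^0,\mathcal{X},\mathcal{A})$, where $\mathcal{X}=\{X^i, i\in\mathcal{I}\}$ is a family of convex polyhedra with $\bigcup_{i\in\mathcal{I}}X^i=\mathbb{R}^d$ and $X^i\cap X^j=\emptyset$ for $i\ne j$; $\mathcal{A}=\{f^i: x\mapsto A^ix+b^i,\ i\in\mathcal{I}\}$ with $A^i\in\mathbb{M}_{d\times d}$, $b^i\in\mathbb{R}^d$; and $X^0$ is a polytope (the set of initial conditions). Each $X^i$ ($i\in\mathcal{I}$) and $X^0$ (index $0$) has the form $X^i=\{x\in\mathbb{R}^d\mid T^i_sx<c^i_s,\ T^i_wx\le c^i_w\}$, where $T^i\in\mathbb{M}_{n_i\times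 d}$ and $c^i\in\mathbb{R}^{n_i}$ collect all the strict (subscript $s$) and weak (subscript $w$) rows. The dynamics is $x_0\in X^0$ and $x_{k+1}=f^i(x_k)$ if $x_k\in X^i$. Put $\mathbb{A}(x)=f^i(x)$ if $x\in X^i$; the reachable values set is $\mathcal{R}=\bigcup_{k\in\mathbb{N}}\mathbb{A}^k(X^0)$. Put $X^{ij}=X^i\cap (f^i)^{-1}(X^j)$, $X^{i0}=X^i\cap X^0$, $\mathrm{Sw}=\{(i,j)\in\mathcal{I}^2\mid\mathcal{R}\cap X^{ij}\neq\emptyset\}$, $\mathrm{In}=\{i\in\mathcal{I}\mid X^{i0}\ne\emptyset\}$. **Matrices.** $F^i=\begin{pmatrix}1&0_{1\times d}\\ b^i&A^i\end{pmatrix}$. For $A\in\mathbb{S}_d$, $b\in\mathbb{R}^d$, $c\in\mathbb{R}$: $\mathbf{M}(A,b,c)=\begin{pmatrix}c&(b/2)^\intercal\\ b/2&A\end{pmatrix}\in\mathbb{S}_{d+1}$. For $T\in\mathbb{M}_{n\times d}$, $c\in\mathbb{R}^n$: $\overline{\mathbf{H}(T,c)}=\begin{pmatrix}1&0_{1\times d}\\ c&-T\end{pmatrix}$. Set $E^i=\overline{\mathbf{H}(T^i,c^i)}$, $E^{ij}=\overline{\mathbf{H}\left(\begin{pmatrix}T^i\\ T^jA^i\end{pmatrix},\begin{pmatrix}c^i\\ c^j-T^jb^i\end{pmatrix}\right)}$, $E^{i0}=\overline{\mathbf{H}\left(\begin{pmatrix}T^i\\ T^0\end{pmatrix},\begin{pmatrix}c^i\\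 c^0\end{pmatrix}\right)}$. For $M\in\mathbb{M}_{m\times n}$, $\mathbf{C}_n(M)$ is the set of $M$-copositive matrices: $Q\in\mathbb{S}_n$ such that $My\ge0$ implies $y^\intercal Qy\ge0$. **PQL function.** $L:\mathbb{R}^d\to\mathbb{R}$ is a PQL function for $P$, characterized by $\{(P^i,q^i)\}_{i\in\mathcal{I}}$ and reals $\alpha,\beta$, if: (1) for all $i\in\mathcal{I}$ and $x\in X^i$, $L(x)=L^i(x)=x^\intercal P^ix+2x^\intercal q^i$; (2) for all $i\in\mathcal{I}$, $\mathbf{M}(P^i,2q^i,-\alpha)-\mathbf{M}(\mathrm{Id},0,-\beta)\in\mathbf{C}_{d+1}(E^i)$; (3) for all $(i,j)\in\mathrm{Sw}$, $\mathbf{M}(P^i,2q^i,0)-{F^i}^\intercal\mathbf{M}(P^j,2q^j,0)F^i\in\mathbf{C}_{d+1}(E^{ij})$; (4) for all $i\in\mathrm{In}$, $-\mathbf{M}(P^i,2q^i,-\alpha)\in\mathbf{C}_{d+1}(E^{i0})$. *)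

(* Defs.v *)
From HB Require Import structures.
From mathcomp Require Import all_boot all_order all_algebra.
From mathcomp Require Import sesquilinear.
From mathcomp Require Import boolp classical_sets reals topology normedtype.

Set Implicit Arguments.
Unset Strict Implicit.
Unset Printing Implicit Defensive.

Import Order.TTheory GRing.Theory Num.Theory.
Import numFieldNormedType.Exports.

Local Open Scope classical_set_scope.
Local Open Scope ring_scope.

Section Definitions.
Variable R : realType.

Definition vle n (u v : 'cV[R]_n) : Prop := forall k, u k 0 <= v k 0.
Definition vlt n (u v : 'cV[R]_n) : Prop := forall k, u k 0 < v k 0.

Definition norm2 d (x : 'cV[R]_d) : R := Num.sqrt (\sum_(k < d) x k 0 ^+ 2).

(* A polyhedron is kept with its inequality description, because the matrices
   Ei, Eij and Ei0 below depend on that description and not only on the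
   underlying set. *)
Record polyhedron (d : nat) := Polyhedron {
  nstrict : nat;
  nweak : nat;
  Tstrict : 'M[R]_(nstrict, d);
  Tweak : 'M[R]_(nweak, d);
  cstrict : 'cV[R]_nstrict;
  cweak : 'cV[R]_nweak }.

Definition poly_set d (X : polyhedron d) : set 'cV[R]_d :=
  [set x | vlt (Tstrict X *m x) (cstrict X) /\ vle (Tweak X *m x) (cweak X)].

Definition nrows d (X : polyhedron d) : nat := (nstrict X + nweak X)%N.
Definition poly_T d (X : polyhedron d) : 'M[R]_(nrows X, d) :=
  col_mx (Tstrict X) (Tweak X).
Definition poly_c d (X : polyhedron d) : 'cV[R]_(nrows X) :=
  col_mx (cstrict X) (cweak X).

Record pwa_system (d : nat) := PwaSystem {
  mode : Type;
  init : polyhedron d;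
  cell : mode -> polyhedron d;
  Amat : mode -> 'M[R]_d;
  bvec : mode -> 'cV[R]_d;
  init_bounded : bounded_set (poly_set init);
  cell_cover : \bigcup_i poly_set (cell i) = setT;
  cell_disjoint : forall i j, i <> j ->
    poly_set (cell i) `&` poly_set (cell j) = set0 }.

Definition quad d (P : 'M[R]_d) (q x : 'cV[R]_d) : R :=
  (x^T *m P *m x) 0 0 + 2 * (x^T *m q) 0 0.

Definition Mform d (A : 'M[R]_d) (b : 'cV[R]_d) (c : R) : 'M[R]_(1 + d) :=
  block_mx c%:M (2^-1 *: b)^T (2^-1 *: b) A.

(* Hbar T c *m (t, x) >= 0 means t >= 0 and T *m x <= t c; in particular the strict
   rows of a polyhedron only contribute weak inequalities. *)
Definition Hbar n d (T : 'M[R]_(n, d)) (c : 'cV[R]_n) : 'M[R]_(1 + n, 1 + d) :=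
  block_mx 1%:M 0 c (- T).

Definition copositive m n (M : 'M[R]_(m, n)) : set 'M[R]_n :=
  [set Q | Q \is symmetricmx /\
    forall y : 'cV[R]_n, vle 0 (M *m y) -> 0 <= (y^T *m Q *m y) 0 0].

Section System.
Variables (d : nat) (P : pwa_system d).
Implicit Types i j : mode P.

Definition cell_set i : set 'cV[R]_d := poly_set (cell i).
Definition init_set : set 'cV[R]_d := poly_set (init P).

Definition affine i (x : 'cV[R]_d) : 'cV[R]_d := Amat i *m x + bvec i.

Lemma cell_ex (x : 'cV[R]_d) : exists i, cell_set i x.
Proof.
have : [set: 'cV[R]_d] x by [].
by rewrite -(cell_cover P) => -[i _ Xix]; exists i.
Qed.

Definition cell_of (x : 'cV[R]_d) : mode P := projT1 (cid (cell_ex x)).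
(* The choice of the cell is immaterial by disjointness, see dynE. *)
Definition dyn (x : 'cV[R]_d) : 'cV[R]_d := affine (cell_of x) x.

Lemma dynE i x : cell_set i x -> dyn x = affine i x.
Proof.
move=> Xix; rewrite /dyn /cell_of; case: cid => j /= Xjx.
have [<-//|ij] := pselect (i = j).
by have := cell_disjoint ij; rewrite -subset0 => /(_ x (conj Xix Xjx)).
Qed.

Definition reach : set 'cV[R]_d := \bigcup_k (iter k dyn @` init_set).

Definition Xij i j : set 'cV[R]_d := cell_set i `&` (affine i @^-1` cell_set j).
Definition Xi0 i : set 'cV[R]_d := cell_set i `&` init_set.
Definition switch : set (mode P * mode P) :=
  [set ij | reach `&` Xij ij.1 ij.2 !=set0].
Definition initial : set (mode P) := [set i | Xi0 i !=set0].

Definition Fmat i : 'M[R]_(1 + d) := block_mx 1%:M 0 (bvec i) (Amat i).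

Definition Ei i := Hbar (poly_T (cell i)) (poly_c (cell i)).
Definition Eij i j :=
  Hbar (col_mx (poly_T (cell i)) (poly_T (cell j) *m Amat i))
       (col_mx (poly_c (cell i)) (poly_c (cell j) - poly_T (cell j) *m bvec i)).
Definition Ei0 i :=
  Hbar (col_mx (poly_T (cell i)) (poly_T (init P)))
       (col_mx (poly_c (cell i)) (poly_c (init P))).

Record is_PQL (L : 'cV[R]_d -> R) (Pm : mode P -> 'M[R]_d)
    (q : mode P -> 'cV[R]_d) (alpha beta : R) : Prop := IsPQL {
  pql_sym : forall i, Pm i \is symmetricmx;
  pql_piece : forall i x, cell_set i x -> L x = quad (Pm i) (q i) x;
  pql_bound : forall i,
    copositive (Ei i)
      (Mform (Pm i) (2 *: q i) (- alpha) - Mform 1%:M 0 (- beta));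
  pql_decr : forall i j, switch (i, j) ->
    copositive (Eij i j)
      (Mform (Pm i) (2 *: q i) 0
       - (Fmat i)^T *m Mform (Pm j) (2 *: q j) 0 *m Fmat i);
  pql_init : forall i, initial i ->
    copositive (Ei0 i) (- Mform (Pm i) (2 *: q i) (- alpha)) }.

Definition sublevel (Pm : mode P -> 'M[R]_d) (q : mode P -> 'cV[R]_d)
    (alpha : R) i : set 'cV[R]_d :=
  [set x | cell_set i x /\ quad (Pm i) (q i) x <= alpha].

End System.
End Definitions.

(* Main.v *)
(** Evaluating the copositivity conditions at the homogenized point (1, x)
    turns them into inequalities on the cells: the reachable set stays in the
    alpha-sublevel by induction on the number of steps (initial condition, then
    decrease along each switch), and the bound condition gives
    |x|^2 - beta <= L x - alpha, which is nonpositive on the sublevel. *)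
Require Import Defs.
From mathcomp Require Import all_boot all_order all_algebra.
From mathcomp Require Import boolp classical_sets reals topology normedtype.
From mathcomp Require Import lra.

Import Order.TTheory GRing.Theory Num.Theory.

Local Open Scope classical_set_scope.
Local Open Scope ring_scope.

(** The coordinate 1 comes first, to match the block order of [Mform], [Hbar] and [Fmat]. *)
Definition homog {R : realType} {d : nat} (x : 'cV[R]_d) : 'cV[R]_(1 + d) :=
  col_mx 1%:M x.

(** Same expression as in [copositive], so that it can be folded there and the matrix identities
    below used for rewriting. *)
Definition qform {R : realType} {n : nat} (Q : 'M[R]_n) (y : 'cV[R]_n) : R :=
  (y^T *m Q *m y) 0 0.

(** Entry rules for a single operation: repeated rewriting with [mxE] would also expand matrix
    products into sums. *)
Lemma addmx_coef (V : nmodType) (m n : nat) (A B : 'M[V]_(m, n)) (i : 'I_m)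
    (j : 'I_n) : (A + B) i j = A i j + B i j.
Proof. by rewrite mxE. Qed.

Lemma submx_coef (V : zmodType) (m n : nat) (A B : 'M[V]_(m, n)) (i : 'I_m)
    (j : 'I_n) : (A - B) i j = A i j - B i j.
Proof. by rewrite !mxE. Qed.

Lemma scalemx_coef (K : pzRingType) (m n : nat) (a : K) (A : 'M[K]_(m, n))
    (i : 'I_m) (j : 'I_n) : (a *: A) i j = a * A i j.
Proof. by rewrite mxE. Qed.

Lemma qformB (R : realType) (n : nat) (Q1 Q2 : 'M[R]_n) (y : 'cV[R]_n) :
  qform (Q1 - Q2) y = qform Q1 y - qform Q2 y.
Proof. by rewrite /qform mulmxBr mulmxBl !mxE. Qed.

Lemma qformN (R : realType) (n : nat) (Q : 'M[R]_n) (y : 'cV[R]_n) :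
  qform (- Q) y = - qform Q y.
Proof. by rewrite /qform mulmxN mulNmx !mxE. Qed.

Lemma qform_congr (R : realType) (m n : nat) (F : 'M[R]_(m, n)) (Q : 'M[R]_m)
    (y : 'cV[R]_n) : qform (F^T *m Q *m F) y = qform Q (F *m y).
Proof. by rewrite /qform trmx_mul !mulmxA. Qed.

Lemma qform_Mform (R : realType) (d : nat) (A : 'M[R]_d) (b x : 'cV[R]_d)
    (c : R) : qform (Mform A b c) (homog x) = qform A x + (x^T *m b) 0 0 + c.
Proof.
(* A 1 x 1 matrix equals its transpose, so the two off-diagonal blocks contribute equal halves of
   the linear term. *)
have bx : (b^T *m x) 0 0 = (x^T *m b) 0 0.
  by rewrite -[in RHS](trmxK b) -trmx_mul [RHS]mxE.
rewrite /qform /homog /Mform tr_col_mx mul_row_block mul_row_col.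
have -> : (2^-1 *: b)^T = 2^-1 *: b^T by rewrite linearZ.
rewrite trmx1 !mul1mx mulmx1 mulmxDl -scalemxAl -scalemxAr.
rewrite !addmx_coef !scalemx_coef [c%:M 0 0]mxE eqxx mulr1n bx; lra.
Qed.

Lemma qform_Mform_quad (R : realType) (d : nat) (A : 'M[R]_d) (b x : 'cV[R]_d)
    (c : R) : qform (Mform A (2 *: b) c) (homog x) = quad A b x + c.
Proof. by rewrite qform_Mform -scalemxAr /quad scalemx_coef. Qed.

Lemma norm2_sqr (R : realType) (d : nat) (x : 'cV[R]_d) :
  norm2 x ^+ 2 = qform 1%:M x.
Proof.
rewrite /norm2 sqr_sqrtr; last by apply: sumr_ge0 => k _; exact: sqr_ge0.
by rewrite /qform mulmx1 mxE; apply: eq_bigr => k _; rewrite mxE expr2.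
Qed.

(** Homogenization makes the affine dynamics linear, so congruence by [Fmat i] amounts to evaluating
    a form at the next state. *)
Lemma Fmat_homog (R : realType) (d : nat) (P : pwa_system R d) (i : mode P)
    (x : 'cV[R]_d) : Fmat i *m homog x = homog (affine i x).
Proof.
by rewrite /Fmat /homog mul_block_col !mul1mx mul0mx addr0 mulmx1 addrC.
Qed.

Lemma vle_col_mx (R : realType) (m n : nat) (u1 v1 : 'cV[R]_m)
    (u2 v2 : 'cV[R]_n) :
  vle u1 v1 -> vle u2 v2 -> vle (col_mx u1 u2) (col_mx v1 v2).
Proof.
move=> h1 h2 k; rewrite -(splitK k); case: (split k) => j /=.
  by rewrite !col_mxEu.
by rewrite !col_mxEd.
Qed.

Lemma Hbar_homog_ge0 (R : realType) (n d : nat) (T : 'M[R]_(n, d))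
    (c : 'cV[R]_n) (x : 'cV[R]_d) :
  vle (T *m x) c -> vle 0 (Hbar T c *m homog x).
Proof.
move=> Txc; rewrite /Hbar /homog mul_block_col mul1mx mul0mx addr0 mulmx1.
(* The top row reads 0 <= 1, the remaining ones 0 <= c - T x. *)
rewrite -(col_mx0 R 1 n 1); apply: vle_col_mx => k.
  by rewrite !mxE ord1 ler01.
by rewrite mulNmx submx_coef [leLHS]mxE subr_ge0.
Qed.

Lemma poly_set_vle (R : realType) (d : nat) (X : polyhedron R d)
    (x : 'cV[R]_d) : poly_set X x -> vle (poly_T X *m x) (poly_c X).
Proof.
move=> [hs hw]; rewrite /poly_T /poly_c mul_col_mx.
by apply: vle_col_mx => // k; exact: ltW (hs k).
Qed.

Section Lyapunov.
Context (R : realType) (d : nat) (P : pwa_system R d).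
Context (L : 'cV[R]_d -> R) (Pm : mode P -> 'M[R]_d) (q : mode P -> 'cV[R]_d).
Context (alpha beta : R) (hL : is_PQL L Pm q alpha beta).

Lemma pql_norm2_le (i : mode P) (x : 'cV[R]_d) : cell_set i x ->
  norm2 x ^+ 2 - beta <= quad (Pm i) (q i) x - alpha.
Proof.
move=> Xix; have [_ /(_ (homog x))] := pql_bound hL i.
move=> /(_ (Hbar_homog_ge0 _ _ _ _ _ _ (poly_set_vle _ _ _ _ Xix))).
rewrite -/(qform _ _) qformB qform_Mform_quad qform_Mform -norm2_sqr.
by rewrite mulmx0 mxE addr0 subr_ge0.
Qed.

Lemma pql_quad_affine_le (i j : mode P) (x : 'cV[R]_d) :
  reach P x -> Xij i j x ->
  quad (Pm j) (q j) (affine i x) <= quad (Pm i) (q i) x.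
Proof.
move=> Rx Xijx; have [Xix Xjfx] := Xijx.
(* Decrease is only assumed along switches met by reachable states; [x] itself is the witness. *)
have sw : switch (i, j) by exists x.
have [_ /(_ (homog x))] := pql_decr hL sw.
rewrite -/(qform _ _) qformB qform_congr Fmat_homog !qform_Mform_quad.
rewrite !addr0 subr_ge0; apply; apply: Hbar_homog_ge0; rewrite mul_col_mx.
apply: vle_col_mx => [|k]; first exact: poly_set_vle.
(* Membership of A x + b in the cell of [j], with the constant term T b moved to the right-hand
   side. *)
have := poly_set_vle _ _ _ _ Xjfx k.
by rewrite /affine mulmxDr mulmxA addmx_coef submx_coef lerBrDr.
Qed.

Lemma pql_init_le (i : mode P) (x : 'cV[R]_d) :
  Xi0 i x -> quad (Pm i) (q i) x <= alpha.
Proof.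
move=> Xi0x; have [Xix X0x] := Xi0x.
have ini : initial i by exists x.
have [_ /(_ (homog x))] := pql_init hL ini.
rewrite -/(qform _ _) qformN qform_Mform_quad oppr_ge0 subr_le0.
apply; apply: Hbar_homog_ge0; rewrite mul_col_mx.
by apply: vle_col_mx; exact: poly_set_vle.
Qed.

Lemma reach_sublevel : reach P `<=` \bigcup_i sublevel Pm q alpha i.
Proof.
move=> _ [k _ [x0 X0x0 <-]]; elim: k => [|k [i _ [Xix Lx]]].
  have [i Xix0] := cell_ex P x0.
  by exists i => //; split => //; apply: pql_init_le.
have [j Xjfx] := cell_ex P (iter k.+1 (@dyn R d P) x0).
(* The induction hypothesis places the k-th iterate in cell [i], so [dyn] acts there as [affine i]
   and that iterate lies in [Xij i j]. *)
exists j => //; split => //; move: Xjfx; rewrite iterS (dynE Xix) => Xjfx.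
apply: le_trans Lx; apply: pql_quad_affine_le => //.
by exists k => //; exists x0.
Qed.

End Lyapunov.

Theorem theorem1 (R : realType) (d : nat) (P : pwa_system R d)
    (L : 'cV[R]_d -> R) (Pm : mode P -> 'M[R]_d) (q : mode P -> 'cV[R]_d)
    (alpha beta : R) (hL : is_PQL L Pm q alpha beta) :
  let S : set 'cV[R]_d := \bigcup_i sublevel Pm q alpha i in
  reach P `<=` S /\ S `<=` [set x | norm2 x ^+ 2 <= beta].
Proof.
split; first exact: reach_sublevel hL.
move=> x [i _ [Xix Lx]] /=.
have := pql_norm2_le _ _ _ _ _ _ _ _ hL _ _ Xix; lra.
Qed.
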